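(* Let $r_i,n_i,k_{ij}$ ($i,j\in[d]$) be integers with $r_i\ge0$, $r_1+\dots+r_d\ge1$, $k_{ij}\ge0$ for $i\ne j$, $-k_{jj}=r_j+\sum_{i\ne j}k_{ij}$ for all $j$, $n_i\ge-k_{ii}$ and $-k_{ii}>0$ for all $i$. Let $\mathcal F_d^{k_{ij},\mathrm n}$ be the set of $d$-type plane forests with $n_i$ vertices of type $i$, $r_i$ roots of type $i$, and such that for $i\ne j$ exactly $k_{ij}$ vertices of type $j$ have a parent of type $i$. Then $$\left|\mathcal F_d^{k_{ij},\mathrm n}\right|=\frac{\det(-k_{ij})}{n_1n_2\cdots n_d}\prod_{i,j=1}^d\binom{n_i+k'_{ij}-1}{k'_{ij}},$$ where $k'_{ii}=n_i+k_{ii}$ and $k'_{ij}=k_{ij}$ for $i\ne j$.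
   Context: $d\ge2$, $[d]=\{1,\dots,d\}$. A $d$-type plane forest is a finite sequence of finite rooted plane (ordered) trees whose vertices each carry a type in $[d]$, such that children of a common parent appear from left to right in nondecreasing order of type; forests are unlabeled (counted up to isomorphism preserving the tree order, planar order and types).
   Formalization: The roots of a forest, like the children of a common parent, are also required to appear in nondecreasing order of type; with roots in arbitrary order the formula fails (e.g. d=2, r=n=(1,1), k=-I gives 2 forests, but the formula gives 1). *)

(* Defs.v *)
From mathcomp Require Import all_boot all_order all_algebra.
Set Implicit Arguments.
Unset Strict Implicit.
Unset Printing Implicit Defensive.
Import Order.TTheory GRing.Theory Num.Theory.
Local Open Scope ring_scope.

(* d-type plane trees: a vertex carries a type in 'I_d (types 0..d-1 stand
   for 1..d) and an ordered (left-to-right) list of children subtrees.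
   Unlabeled: Leibniz equality of these terms is isomorphism preserving
   planar order and types. *)
Inductive ptree (d : nat) : Type :=
  PNode : 'I_d -> seq (ptree d) -> ptree d.

Definition pforest (d : nat) := seq (ptree d).

Definition ptype d (t : ptree d) : 'I_d := let: PNode a _ := t in a.

Definition type_sorted d (s : seq (ptree d)) : bool :=
  sorted (fun t u => (nat_of_ord (ptype t) <= nat_of_ord (ptype u))%N) s.

Fixpoint wf_ptree d (t : ptree d) : bool :=
  let: PNode _ cs := t in type_sorted cs && all (@wf_ptree d) cs.

(* d-type plane forest: each tree is well formed and the roots (children of
   the implicit common "super-root") are also in nondecreasing type order *)
Definition wf_pforest d (F : pforest d) : bool :=
  type_sorted F && all (@wf_ptree d) F.

Fixpoint nvert_tree d (i : 'I_d) (t : ptree d) : nat :=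
  let: PNode a cs := t in ((a == i) + sumn (map (nvert_tree i) cs))%N.

Definition nvert d (i : 'I_d) (F : pforest d) : nat :=
  sumn (map (nvert_tree i) F).

Definition nroots d (i : 'I_d) (F : pforest d) : nat :=
  count (fun t => ptype t == i) F.

Fixpoint nedge_tree d (i j : 'I_d) (t : ptree d) : nat :=
  let: PNode a cs := t in
  ((a == i) * count (fun c => ptype c == j) cs + sumn (map (nedge_tree i j) cs))%N.

Definition nedge d (i j : 'I_d) (F : pforest d) : nat :=
  sumn (map (nedge_tree i j) F).

Definition in_family d (r n : 'I_d -> int) (k : 'M[int]_d) (F : pforest d) :
  Prop :=
  wf_pforest F /\
  (forall i, Posz (nvert i F) = n i) /\
  (forall i, Posz (nroots i F) = r i) /\
  (forall i j, i != j -> Posz (nedge i j F) = k i j).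

Definition kprime d (n : 'I_d -> int) (k : 'M[int]_d) (i j : 'I_d) : int :=
  if i == j then n i + k i i else k i j.

(* Main.v *)
(** Read a forest depth first, keeping the word of types of the pending roots.
    Popping a first root of type j with x_l children of type l replaces n by
    n - e_j and row j of (k'_ij) by k'_j - x, so the number of forests is the sum
    over x of the numbers of forests with the reduced data. The closed formula,
    with matrix M_ij = n_j [i = j] - k'_ij, satisfies the same recursion: only row
    j of M changes, the determinant is linear in it, and the sums over x of the
    binomial weights, alone or times x_l, are elementary. When no root is left but
    vertices are, the rows of M sum to zero and both sides vanish. *)
Require Import Defs.
From HB Require Import structures.
From mathcomp Require Import all_boot all_order all_algebra.
From mathcomp Require Import ring zify.
From Stdlib Require List.
Set Implicit Arguments.
Unset Strict Implicit.
Unset Printing Implicit Defensive.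
Import Order.TTheory GRing.Theory Num.Theory.
Local Open Scope ring_scope.

(** * Multiset coefficients and their convolution sums *)

(** Counts the ways to share [b] children among [a] ordered parents. The truncated subtraction gives
    the right values at [a = 0]: 1 for [b = 0] and 0 otherwise. *)
Definition multichoose (a b : nat) : nat := 'C(a + b - 1, b).

Lemma multichoose1n b : multichoose 1 b = 1%N.
Proof. by rewrite /multichoose add1n subn1 binn. Qed.

Lemma multichoose0n b : multichoose 0 b = (b == 0)%N.
Proof.
rewrite /multichoose; case: b => [|b]; first by rewrite bin0.
by rewrite bin_small //; lia.
Qed.

Lemma sum_multichoose a b :
  (\sum_(x < b.+1) multichoose a.+1 (b - x) = multichoose a.+2 b)%N.
Proof.
elim: b => [|b IHb]; first by rewrite big_ord1 /multichoose !bin0.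
rewrite big_ord_recl subn0.
under eq_bigr => i _ do rewrite /= subSS.
rewrite IHb /multichoose.
have -> : (a.+2 + b.+1 - 1 = (a.+1 + b).+1)%N by lia.
have -> : (a.+1 + b.+1 - 1 = (a.+1 + b))%N by lia.
by have -> : (a.+2 + b - 1 = (a.+1 + b))%N by lia.
Qed.

(** By symmetry each of the [a + 2] parts of a weak composition of [b] has mean [b / (a + 2)]. The
    induction on [b] shifts [x] by one, which brings in the unweighted sum. *)
Lemma sum_weighted_multichoose a b :
  (a.+2 * \sum_(x < b.+1) x * multichoose a.+1 (b - x)
   = b * multichoose a.+2 b)%N.
Proof.
elim: b => [|b IHb]; first by rewrite big_ord1 !mul0n muln0.
rewrite big_ord_recl mul0n add0n.
under eq_bigr => i _ do rewrite /= subSS /bump leq0n add1n mulSn.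
rewrite big_split /= mulnDr IHb sum_multichoose -mulnDl /multichoose.
have -> : (a.+2 + b.+1 - 1 = (a.+2 + b - 1).+1)%N by lia.
by rewrite -mul_bin_diag; congr (_ * _)%N; lia.
Qed.

Lemma sum_ord_le (V : nmodType) B m (F : nat -> V) : (m < B)%N ->
  \sum_(y < B | (y <= m)%N) F y = \sum_(y < m.+1) F y.
Proof. by move=> mB; rewrite (big_ord_widen B F). Qed.

Lemma maxn1S a : maxn 1 a.+1 = a.+1.
Proof. by rewrite maxnE; lia. Qed.

(** * The closed formula and its recursion *)

Section Formula.
Variable d : nat.
Implicit Types (n : 'I_d -> nat) (k : 'I_d -> 'I_d -> nat).

(* Replacing n_j = 0 by 1 turns the row and column of an absent type into
   those of the identity matrix, so that absent types are harmless. *)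
Definition forest_mx n k : 'M[rat]_d :=
  \matrix_(i, j) ((i == j)%:R * (maxn 1 (n j))%:R - (k i j)%:R).

Definition forest_formula n k : rat :=
  \det (forest_mx n k) / \prod_i (maxn 1 (n i))%:R
  * \prod_i \prod_j (multichoose (n i) (k i j))%:R.

Definition pop_vert n (j : 'I_d) : 'I_d -> nat := fun i => (n i - (i == j))%N.

Definition pop_edge k (j : 'I_d) (x : 'I_d -> nat) : 'I_d -> 'I_d -> nat :=
  fun i l => (k i l - (i == j) * x l)%N.

(** Isolates what depends on row [j]: [n j] enters the matrix only in the diagonal entry of that
    row, so the cofactors along it are those of the unmodified data. *)
Lemma forest_formula_row n k n' k' (j : 'I_d) :
  (forall i, i != j -> n' i = n i) ->
  (forall i, i != j -> k' i =1 k i) ->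
  forest_formula n' k' =
  (\sum_l ((j == l)%:R * (maxn 1 (n' j))%:R - (k' j l)%:R)
     * cofactor (forest_mx n k) j l)
  / (maxn 1 (n' j))%:R / (\prod_(i | i != j) (maxn 1 (n i))%:R)
  * (\prod_(i | i != j) \prod_l (multichoose (n i) (k i l))%:R)
  * \prod_l (multichoose (n' j) (k' j l))%:R.
Proof.
move=> En Ek; rewrite /forest_formula (expand_det_row _ j).
rewrite [\prod_i (maxn 1 (n' i))%:R](bigD1 j) //=.
rewrite [\prod_i \prod_l (multichoose (n' i) (k' i l))%:R](bigD1 j) //=.
have -> : \prod_(i | i != j) (maxn 1 (n' i))%:R =
          \prod_(i | i != j) (maxn 1 (n i))%:R :> rat.
  by apply: eq_bigr => i /En ->.
have -> : \prod_(i | i != j) \prod_l (multichoose (n' i) (k' i l))%:R =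
          \prod_(i | i != j) \prod_l (multichoose (n i) (k i l))%:R :> rat.
  by apply: eq_bigr => i ij; apply: eq_bigr => l _; rewrite En // Ek.
rewrite invfM [X in _ * X]mulrC !mulrA; congr (_ * _ * _ * _ * _).
apply: eq_bigr => l _; rewrite mxE; congr (_ * _).
  by case: eqP => [->|_] //; rewrite !mul0r.
rewrite /cofactor; congr (_ * \det _); apply/matrixP => i m; rewrite !mxE.
have jl : lift j i != j by rewrite eq_sym neq_lift.
rewrite Ek //; case: eqP => [E|_]; last by rewrite !mul0r.
by rewrite -E En.
Qed.

Lemma sum_family_multichoose a B (K : 'I_d -> nat) :
  (forall l, K l < B)%N ->
  \sum_(x in family (fun l (y : 'I_B) => y <= K l)%N)
     \prod_l (multichoose a.+1 (K l - x l))%:R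
  = \prod_l (multichoose a.+2 (K l))%:R :> rat.
Proof.
move=> KB.
rewrite -(bigA_distr_big_dep _ (fun l (y : 'I_B) => (multichoose a.+1 (K l - y))%:R)).
apply: eq_bigr => l _.
by rewrite -sum_multichoose natr_sum
  (sum_ord_le (fun y => (multichoose a.+1 (K l - y))%:R)).
Qed.

Lemma sum_family_weighted_multichoose a B (K : 'I_d -> nat) (m : 'I_d) :
  (forall l, K l < B)%N ->
  a.+2%:R * \sum_(x in family (fun l (y : 'I_B) => y <= K l)%N)
     (x m)%:R * \prod_l (multichoose a.+1 (K l - x l))%:R
  = (K m)%:R * \prod_l (multichoose a.+2 (K l))%:R :> rat.
Proof.
move=> KB.
(* The weight [x m] goes into the factor of index [m], so the summand stays a product over
   coordinates and the sum over [x] factors. *)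
pose G l (y : nat) : rat :=
  (if l == m then y%:R else 1) * (multichoose a.+1 (K l - y))%:R.
transitivity (a.+2%:R * \sum_(x in family (fun l (y : 'I_B) => y <= K l)%N)
     \prod_l G l (x l)).
  congr (_ * _); apply: eq_bigr => x _.
  rewrite /G big_split /=; congr (_ * _).
  rewrite (bigD1 m) //= eqxx big1 ?mulr1 // => i /negPf -> //.
rewrite -(bigA_distr_big_dep _ (fun l (y : 'I_B) => G l y)).
rewrite (bigD1 m) //= mulrA [in RHS](bigD1 m) //= mulrA; congr (_ * _).
  rewrite -natrM -sum_weighted_multichoose natrM natr_sum.
  rewrite sum_ord_le //; congr (_ * _).
  by apply: eq_bigr => y _; rewrite /G eqxx natrM.
apply: eq_bigr => l /negPf lm.
rewrite -sum_multichoose natr_sum sum_ord_le //.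
by apply: eq_bigr => y _; rewrite /G lm mul1r.
Qed.

(* The summands are affine in the row x, so only the total weight and the mean
   of x matter; that mean is k_j / n_j, and M_j + k_j / n_j - e_j is
   (1 - 1 / n_j) M_j. *)
Lemma forest_formula_pop_many n k (j : 'I_d) B :
  (1 < n j)%N -> (forall l, k j l < B)%N ->
  \sum_(x in family (fun l (y : 'I_B) => y <= k j l)%N)
     forest_formula (pop_vert n j) (pop_edge k j (fun l => x l))
  = forest_formula n k.
Proof.
move=> nj kB; case Dn: (n j) nj => [|[|a]] // _.
have En i : i != j -> pop_vert n j i = n i.
  by rewrite /pop_vert => /negPf ->; rewrite subn0.
have Ek x i : i != j -> pop_edge k j x i =1 k i.
  by rewrite /pop_edge => /negPf -> l; rewrite mul0n subn0.
rewrite (eq_bigr _ (fun (x : {ffun 'I_d -> 'I_B}) _ =>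
  forest_formula_row En (Ek (fun l => x l)))).
rewrite (@forest_formula_row n k n k j) // Dn.
have Dn' : pop_vert n j j = a.+1 by rewrite /pop_vert eqxx Dn subn1.
rewrite Dn' !maxn1S.
set P := \prod_(i | _) (_)%:R; set W := \prod_(i | _) _.
set c := cofactor _ j.
pose S : rat := \prod_l (multichoose a.+2 (k j l))%:R.
pose C (x : {ffun 'I_d -> 'I_B}) : rat :=
  \prod_l (multichoose a.+1 (k j l - x l))%:R.
(* Exchanging the sums leaves, for each column [l], the sum over [x] of an affine function of [x l]
   against the weight [C x]. *)
transitivity (a.+1%:R^-1 * P^-1 * W * \sum_l c l *
  \sum_(x in family (fun l (y : 'I_B) => y <= k j l)%N)
    ((j == l)%:R * a.+1%:R - (k j l)%:R + (x l)%:R) * C x).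
  under [in RHS]eq_bigr => l _ do rewrite mulr_sumr.
  rewrite exchange_big mulr_sumr; apply: eq_bigr => x xk.
  have -> : \prod_l (multichoose a.+1 (pop_edge k j (fun l => x l) j l))%:R = C x.
    by apply: eq_bigr => l _; rewrite /pop_edge eqxx mul1n.
  have -> : \sum_l c l * (((j == l)%:R * a.+1%:R - (k j l)%:R + (x l)%:R) * C x)
    = (\sum_l ((j == l)%:R * a.+1%:R - (k j l)%:R + (x l)%:R) * c l) * C x.
    by rewrite mulr_suml; apply: eq_bigr => l _; ring.
  have -> : \sum_l ((j == l)%:R * a.+1%:R - (pop_edge k j (fun l => x l) j l)%:R) * c l
    = \sum_l ((j == l)%:R * a.+1%:R - (k j l)%:R + (x l)%:R) * c l.
    apply: eq_bigr => l _; rewrite /pop_edge eqxx mul1n.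
    rewrite natrB ?opprB ?addrA ?[_ - _ + _]addrAC //.
    by move/familyP: xk => /(_ l).
  ring.
(* The factor [(a + 1) / (a + 2)] is common to all columns and turns the prefactor [1 / (a + 1)] of
   the popped data into the original [1 / (a + 2)]. *)
have E l : \sum_(x in family (fun l (y : 'I_B) => y <= k j l)%N)
    ((j == l)%:R * a.+1%:R - (k j l)%:R + (x l)%:R) * C x
    = a.+1%:R / a.+2%:R * (((j == l)%:R * a.+2%:R - (k j l)%:R) * S).
  under eq_bigr => x _ do rewrite mulrDl.
  rewrite big_split /= -mulr_sumr sum_family_multichoose //.
  have := @sum_family_weighted_multichoose a B (k j) l kB; rewrite -/S.
  set T := \sum_(_ in _) _ => ET.
  have nz : a.+2%:R != 0 :> rat by rewrite pnatr_eq0.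
  have -> : T = (k j l)%:R * S / a.+2%:R by rewrite -ET mulrC mulKf.
  move: nz; rewrite -[a.+2]addn2 -[a.+1]addn1 !natrD => nz.
  by field.
rewrite (eq_bigr _ (fun l _ => congr1 (fun z => c l * z) (E l))).
have -> : \sum_l c l * (a.+1%:R / a.+2%:R * (((j == l)%:R * a.+2%:R - (k j l)%:R) * S))
  = a.+1%:R / a.+2%:R * S * \sum_l ((j == l)%:R * a.+2%:R - (k j l)%:R) * c l.
  by rewrite mulr_sumr; apply: eq_bigr => l _; ring.
rewrite -/S; set Z := \sum_l _.
have nz1 : a.+1%:R != 0 :> rat by rewrite pnatr_eq0.
have nz2 : a.+2%:R != 0 :> rat by rewrite pnatr_eq0.
move: a.+1%:R a.+2%:R P^-1 nz1 nz2 => a1 a2 P' nz1 nz2.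
by field; apply/andP.
Qed.

(** An absent type cannot have children: the factor [multichoose 0 b] with [b > 0] vanishes. *)
Lemma forest_formula_eq0 n k (i l : 'I_d) :
  n i = 0%N -> (k i l != 0)%N -> forest_formula n k = 0.
Proof.
move=> ni kil; rewrite /forest_formula.
suff -> : \prod_i \prod_j (multichoose (n i) (k i j))%:R = 0 :> rat.
  by rewrite mulr0.
apply/eqP/prodf_eq0; exists i => //; apply/prodf_eq0; exists l => //.
by rewrite ni multichoose0n (negPf kil).
Qed.

(** The popped root is the last vertex of its type, so it must take all children recorded in row
    [j]: every [x] other than [k j] leaves children to an absent type and contributes 0. *)
Lemma forest_formula_pop_one n k (j : 'I_d) B :
  n j = 1%N -> (forall i, k i j = 0)%N -> (forall l, k j l < B)%N ->
  \sum_(x in family (fun l (y : 'I_B) => y <= k j l)%N)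
     forest_formula (pop_vert n j) (pop_edge k j (fun l => x l))
  = forest_formula n k.
Proof.
move=> nj kj kB.
have n'j : pop_vert n j j = 0%N by rewrite /pop_vert nj eqxx.
have En i : i != j -> pop_vert n j i = n i.
  by rewrite /pop_vert => /negPf ->; rewrite subn0.
have Ek x i : i != j -> pop_edge k j x i =1 k i.
  by rewrite /pop_edge => /negPf -> l; rewrite mul0n subn0.
pose x0 : {ffun 'I_d -> 'I_B} := [ffun l => Ordinal (kB l)].
rewrite (bigD1 x0) /=; last by apply/familyP => l; rewrite unfold_in ffunE /=.
rewrite big1 ?addr0 => [|x /andP[/familyP xk xx0]]; last first.
  have [l xl] : exists l, x l != k j l :> nat.
    apply/existsP; apply: contraNT xx0 => /existsPn H; apply/eqP/ffunP => l.
    by apply/val_inj; rewrite ffunE /=; apply/eqP; move: (H l); rewrite negbK.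
  apply: (forest_formula_eq0 (l := l) n'j).
  have := xk l; rewrite unfold_in => xkl.
  by rewrite /pop_edge eqxx mul1n subn_eq0 leqNgt ltn_neqAle xl xkl.
have k'j l : pop_edge k j (fun l => x0 l) j l = 0%N.
  by rewrite /pop_edge eqxx ffunE mul1n subnn.
(* The convention [maxn 1] acts here: the values 1 and 0 of [n j] before and after popping give the
   same denominator and the same diagonal entry. *)
have max1 : (maxn 1 (pop_vert n j j) = maxn 1 (n j))%N by rewrite n'j nj.
rewrite /forest_formula; congr (_ / _ * _); last first.
- apply: eq_bigr => i _; apply: eq_bigr => l _.
  have [->|ij] := eqVneq i j; last by rewrite En // Ek.
  by rewrite n'j k'j nj multichoose1n multichoose0n.
- by apply: eq_bigr => i _; have [->|ij] := eqVneq i j; rewrite ?max1 ?En.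
(* Column j of both matrices is e_j, so their j-th rows do not matter. *)
rewrite (expand_det_col _ j) [RHS](expand_det_col _ j).
rewrite (bigD1 j) //= [RHS](bigD1 j) //= !big1 ?addr0 => [|i ij|i ij]; first last.
- by rewrite mxE Ek // (negPf ij) kj mul0r subrr mul0r.
- by rewrite mxE (negPf ij) kj mul0r subrr mul0r.
congr (_ * _); first by rewrite !mxE max1 k'j kj.
rewrite /cofactor; congr (_ * \det _); apply/matrixP => i m; rewrite !mxE.
by rewrite Ek 1?eq_sym ?neq_lift // En // eq_sym neq_lift.
Qed.

Lemma forest_formula_no_root n k :
  (forall j, \sum_i k i j = n j)%N -> (exists j, n j != 0)%N ->
  forest_formula n k = 0.
Proof.
move=> Hk [j0 nj0]; 
have [/existsP[i /existsP[l /andP[/eqP ni kil]]]|] :=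
  boolP [exists i, exists l, (n i == 0)%N && (k i l != 0)%N].
  exact: (forest_formula_eq0 ni kil).
move=> /existsPn H.
(* Absent types now have zero rows in [k], so summing only over the types that occur keeps all
   column sums. *)
have k0 i l : n i = 0%N -> k i l = 0%N.
  move=> ni; apply/eqP; move: (H i) => /existsPn/(_ l).
  by rewrite ni eqxx /= negbK.
rewrite /forest_formula; suff -> : \det (forest_mx n k) = 0 by rewrite !mul0r.
(* The rows of the types that do occur sum to 0. *)
apply/eqP/det0P; exists (\row_i (n i != 0)%:R).
  by apply/eqP => /rowP/(_ j0)/eqP; rewrite !mxE nj0 oner_eq0.
apply/rowP => l; rewrite !mxE.
under eq_bigr => i _ do rewrite !mxE mulrBr.
rewrite sumrB (bigD1 l) //= eqxx big1 => [|i /negPf ->]; last by rewrite mul0r mulr0.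
rewrite addr0 mul1r -natrM.
under eq_bigr => i _ do rewrite -natrM.
rewrite -natr_sum.
have -> : (\sum_i (n i != 0) * k i l = n l)%N.
  rewrite -Hk; apply: eq_bigr => i _.
  by case: (altP (n i =P 0)%N) => [/k0 ->|_]; rewrite ?mul1n.
by case: (n l) => [|a]; rewrite ?maxn1S ?mul1n ?mul0n subrr.
Qed.

Lemma forest_formula_empty n k :
  (forall j, n j = 0)%N -> (forall i j, k i j = 0)%N -> forest_formula n k = 1.
Proof.
move=> n0 k0; rewrite /forest_formula.
have -> : forest_mx n k = 1%:M.
  by apply/matrixP => i j; rewrite !mxE n0 k0 subr0 mulr1.
rewrite det1 big1 => [|i _]; last by rewrite n0.
rewrite invr1 mul1r big1 // => i _; rewrite big1 // => j _.
by rewrite n0 k0 multichoose0n.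
Qed.

(** The strict inequality says that a root of type [j] is pending; for [n j = 1] it forces column
    [j] of [k] to vanish. *)
Lemma forest_formula_pop n k (j : 'I_d) B :
  (\sum_i k i j < n j)%N -> (forall l, k j l < B)%N ->
  \sum_(x in family (fun l (y : 'I_B) => y <= k j l)%N)
     forest_formula (pop_vert n j) (pop_edge k j (fun l => x l))
  = forest_formula n k.
Proof.
move=> kn kB; case: (ltngtP (n j) 1) => [|nj|nj].
- by case: (n j) kn.
- exact: forest_formula_pop_many.
apply: forest_formula_pop_one => // i; move: kn.
by rewrite nj ltnS leqn0 sum_nat_eq0 => /forallP/(_ i)/eqP.
Qed.
End Formula.

(** * Enumeration of forests *)

(** Children sit in a list, so the induction hypothesis must cover all of them; the [foldr] form
    unfolds along an inner induction on that list. *)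
Lemma ptree_nested_ind d (P : ptree d -> Prop) :
  (forall a cs, foldr (fun c => and (P c)) True cs -> P (PNode a cs)) ->
  forall t, P t.
Proof.
move=> IH; fix rec 1 => -[a cs]; apply: IH.
by elim: cs => //= c cs IHcs; split.
Qed.

(** An injective coding into [GenTree.tree nat], from which trees inherit decidable equality. *)
Fixpoint ptree_code d (t : ptree d) : GenTree.tree nat :=
  let: PNode a cs := t in GenTree.Node a (map (@ptree_code d) cs).

Lemma ptree_code_inj d : injective (@ptree_code d).
Proof.
elim/ptree_nested_ind => a cs IH [b cs'] /= [/val_inj <- E]; congr PNode.
elim: cs IH cs' E => [|c cs IHcs] /= => [_ [] //|[IHc /IHcs IH] [|c' cs'] //=].
by case=> /IHc -> /IH ->.
Qed.

HB.instance Definition _ d := Equality.copy (ptree d) (inj_type (@ptree_code_inj d)).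

(** * Forests with a prescribed word of root types *)

Section Forests.
Variable d : nat.
Implicit Types (n x : 'I_d -> nat) (k : 'I_d -> 'I_d -> nat).
Implicit Types (F G : pforest d) (w : seq 'I_d).

Definition type_le : rel 'I_d := fun i j => (i <= j)%N.

(** The explicit [sort] makes sortedness immediate; by [type_wordP] this is the only nondecreasing
    word with these letter counts. *)
Definition type_word x : seq 'I_d :=
  sort type_le (flatten [seq nseq (x l) l | l <- enum 'I_d]).

Lemma count_type_word x l : count_mem l (type_word x) = x l.
Proof.
rewrite count_sort count_flatten -map_comp sumnE big_map big_enum /=.
rewrite (bigD1 l) //= count_nseq /= eqxx mul1n big1 ?addn0 // => i il.
by rewrite count_nseq /= (negPf il).
Qed.

Lemma sorted_type_word x : sorted type_le (type_word x).
Proof. by apply: sort_sorted => i j; apply: leq_total. Qed.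

Lemma type_wordP w x :
  (sorted type_le w && [forall l, count_mem l w == x l]) = (w == type_word x).
Proof.
apply/andP/eqP => [[sw /forallP cw]|->]; last first.
  by rewrite sorted_type_word; split=> //; apply/forallP => l; rewrite count_type_word.
apply: (sorted_eq (leT := type_le)) => //.
- by move=> i j l; apply: leq_trans.
- by move=> i j; rewrite /type_le -eqn_leq => /eqP/val_inj.
- exact: sorted_type_word.
by apply/allP => l _ /=; rewrite count_type_word; apply: cw.
Qed.

Lemma type_sorted_ptype F : type_sorted F = sorted type_le (map (@ptype d) F).
Proof. by rewrite sorted_map. Qed.

Lemma count_ptype F i :
  count (fun t => ptype t == i) F = count_mem i (map (@ptype d) F).
Proof. by rewrite count_map. Qed.

Lemma nvert_cat i F G : nvert i (F ++ G) = (nvert i F + nvert i G)%N.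
Proof. by rewrite /nvert map_cat sumn_cat. Qed.

Lemma nedge_cat i j F G : nedge i j (F ++ G) = (nedge i j F + nedge i j G)%N.
Proof. by rewrite /nedge map_cat sumn_cat. Qed.

(** Each vertex is a root or the child of exactly one parent. This recovers the edge counts between
    equal types, which [in_family] does not prescribe. *)
Lemma nvert_roots_edges F j :
  nvert j F = (nroots j F + \sum_i nedge i j F)%N.
Proof.
suff E t : nvert_tree j t = ((ptype t == j) + \sum_i nedge_tree i j t)%N.
  elim: F => [|t F IH]; first by rewrite big1.
  rewrite /nvert /= -/(nvert j F) IH E /nroots /= -!addnA; congr addn.
  by rewrite addnCA; congr addn; rewrite -big_split.
elim/ptree_nested_ind: t => a cs IH /=; congr addn.
rewrite big_split /= (bigD1 a) //= eqxx mul1n big1 ?addn0 => [|i /negPf]; last first.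
  by rewrite eq_sym => ->.
elim: cs IH => [|c cs IHcs] /= => [_|[-> /IHcs ->]]; first by rewrite big1.
by rewrite -!addnA; congr addn; rewrite addnCA; congr addn; rewrite -big_split.
Qed.

(** The word [w] fixes the root types in order and need not be sorted, since popping puts the
    children of the popped root before the remaining roots. Diagonal edge counts are prescribed
    too. *)
Definition forest_class w n k F : bool :=
  [&& all (@wf_ptree d) F, map (@ptype d) F == w, [forall i, nvert i F == n i]
    & [forall i, forall j, nedge i j F == k i j]].

(** Inverse of popping: the leading trees of [G] become the children of a new first root. *)
Definition unpop (j : 'I_d) x G : pforest d :=
  let m := size (type_word x) in PNode j (take m G) :: drop m G.

Lemma forest_class_unpop j w n k x G :
  (0 < n j)%N -> (forall l, x l <= k j l)%N ->
  forest_class (type_word x ++ w) (pop_vert n j) (pop_edge k j x) G ->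
  forest_class (j :: w) n k (unpop j x G).
Proof.
move=> nj xk /and4P[wfG /eqP tG /forallP nG /forallP kG].
rewrite /unpop; set m := size _.
have tm : map (@ptype d) (take m G) = type_word x.
  by rewrite map_take tG take_size_cat.
move: wfG nG kG; rewrite -{1 2 3}(cat_take_drop m G) all_cat => /andP[wf1 wf2] nG kG.
apply/and4P; split.
- rewrite /= wf1 wf2 !andbT type_sorted_ptype tm.
  exact: sorted_type_word.
- by rewrite /= map_drop tG drop_size_cat.
- apply/forallP => i; rewrite /nvert /= -/(nvert i (take m G)) -addnA -/(nvert i (drop m G)).
  have := nG i; rewrite nvert_cat /pop_vert [i == j]eq_sym => /eqP ->.
  by rewrite subnKC //; case: (j =P i) => // <-.
apply/forallP => i; apply/forallP => l.
rewrite /nedge /= -/(nedge i l (take m G)) -addnA -/(nedge i l (drop m G)).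
have /forallP/(_ l) := kG i; rewrite nedge_cat /pop_edge [i == j]eq_sym => /eqP ->.
rewrite count_ptype tm count_type_word subnKC //.
by case: (j =P i) => // <-; rewrite mul1n.
Qed.

(** The children of the first root are sorted, so their types spell [type_word x] for their vector
    [x] of counts by type. *)
Lemma forest_class_pop j w n k F :
  forest_class (j :: w) n k F ->
  exists x G, [/\ forall l, (x l <= k j l)%N,
    forest_class (type_word x ++ w) (pop_vert n j) (pop_edge k j x) G
    & F = unpop j x G].
Proof.
case: F => [|[a cs] F] /and4P[//= /andP[/andP[scs wcs] wF] /eqP[aj tF]].
subst a => /forallP nF /forallP kF.
pose x l := count (fun t => ptype t == l) cs.
have tcs : map (@ptype d) cs = type_word x.
  apply/eqP; rewrite -type_wordP -type_sorted_ptype scs.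
  by apply/forallP => l; rewrite -count_ptype.
have scs' : size (type_word x) = size cs by rewrite -tcs size_map.
have Ek i l : (k i l = (j == i) * x l + nedge i l (cs ++ F))%N.
  by have /forallP/(_ l)/eqP <- := kF i; rewrite nedge_cat addnA.
exists x, (cs ++ F); split.
- by move=> l; rewrite Ek eqxx mul1n leq_addr.
- apply/and4P; split.
  + by rewrite all_cat wcs.
  + by rewrite map_cat tcs tF.
  + apply/forallP => i; rewrite /pop_vert -(eqP (nF i)) nvert_cat [i == j]eq_sym.
    by rewrite /nvert /= -addnA addKn.
  + apply/forallP => i; apply/forallP => l.
    by rewrite /pop_edge Ek [i == j]eq_sym addKn.
- by rewrite /unpop scs' take_size_cat // drop_size_cat.
Qed.

(** The types of the children of the new root determine [x], so different rows [x] give disjoint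
    sets of forests. *)
Lemma unpop_inj j w w' x x' G G' :
  map (@ptype d) G = type_word x ++ w -> map (@ptype d) G' = type_word x' ++ w' ->
  unpop j x G = unpop j x' G' -> x =1 x' /\ G = G'.
Proof.
move=> tG tG' [Et Ed]; split; last first.
  by rewrite -(cat_take_drop (size (type_word x)) G) Et Ed cat_take_drop.
move=> l; rewrite -(count_type_word x) -(count_type_word x').
have := congr1 (map (@ptype d)) Et.
by rewrite !map_take tG tG' !take_size_cat // => ->.
Qed.

(** Induction on the number of vertices. The hypothesis, that each vertex is a pending root or a
    child, is the invariant preserved by popping. *)
Lemma forest_class_enum w n k :
  (forall j, count_mem j w + \sum_i k i j = n j)%N ->
  exists s : seq (pforest d),
    [/\ uniq s, s =i forest_class w n k & (size s)%:R = forest_formula n k].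
Proof.
move Dm : (\sum_i n i)%N => m.
elim: m w n k Dm => [|m IH] w n k Dm Hn.
  have n0 j : n j = 0%N.
    by move/eqP: Dm; rewrite sum_nat_eq0 => /forallP/(_ j)/eqP.
  have k0 i j : k i j = 0%N.
    move/eqP: (Hn j); rewrite n0 addn_eq0 sum_nat_eq0 => /andP[_ /forallP/(_ i)].
    by move/eqP.
  have w0 : w = [::].
    case: w Hn => // j w /(_ j) /=; by rewrite eqxx n0.
  exists [:: [::]]; split=> //; last by rewrite forest_formula_empty.
  move=> F; rewrite inE unfold_in w0; apply/eqP/and4P => [->|[_]].
    split=> //; first by apply/forallP => i; rewrite n0.
    by apply/forallP => i; apply/forallP => j; rewrite k0.
  by case: F.
(* Vertices but no pending root: the class is empty and the formula vanishes. *)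
case: w Hn => [|j w] Hn.
  exists [::]; split=> //.
    move=> F; rewrite unfold_in; apply/esym/and4P => -[_ /eqP].
    case: F => // _ /forallP n0; move: Dm; rewrite big1 // => i _.
    by apply/esym/eqP; apply: n0.
  rewrite forest_formula_no_root //.
  apply/existsP; apply/contraT => /existsPn n0; move: Dm; rewrite big1 // => i _.
  by apply/eqP; move: (n0 i); rewrite negbK.
have kn : (\sum_i k i j < n j)%N.
  by rewrite -Hn /= eqxx; lia.
have nj : (0 < n j)%N by apply: leq_ltn_trans kn.
(* A common strict bound on row [j], so that [x] ranges over a finite type. *)
pose B := (\sum_l k j l).+1.
have kB l : (k j l < B)%N by rewrite ltnS (bigD1 l) //= leq_addr.
pose Q := family (fun l (y : 'I_B) => (y <= k j l)%N).
pose C (x : {ffun 'I_d -> 'I_B}) := forest_class (type_word (fun l => x l) ++ w)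
  (pop_vert n j) (pop_edge k j (fun l => x l)).
have /fin_all_exists[s Hs] : forall x : {ffun 'I_d -> 'I_B},
    exists s : seq (pforest d), x \in Q ->
    [/\ uniq s, s =i C x & (size s)%:R =
       forest_formula (pop_vert n j) (pop_edge k j (fun l => x l))].
  move=> x; have [xQ|_] := boolP (x \in Q); last by exists [::].
  have Em : (\sum_i pop_vert n j i = m)%N.
    move: Dm; rewrite (bigD1 j) //= [in X in _ -> X](bigD1 j) //= /pop_vert eqxx.
    have -> : (\sum_(i | i != j) (n i - (i == j)) = \sum_(i | i != j) n i)%N.
      by apply: eq_bigr => i /negPf ->; rewrite subn0.
    by move=> D; rewrite addnBAC // subn1; exact: (congr1 predn D).
  have [|s Hs] := IH (type_word (fun l => x l) ++ w) _ (pop_edge k j (fun l => x l)) Em;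
    last by exists s.
  (* The new pending roots add [x l] to the count of [l], exactly what column [l] loses; the popped
     root accounts for the drop of [n j]. *)
  move=> l; rewrite count_cat count_type_word /pop_vert -Hn /=.
  have -> : (\sum_i k i l = \sum_i pop_edge k j (fun l => x l) i l + x l)%N.
    rewrite (bigD1 j) //= [in RHS](bigD1 j) //= {1}/pop_edge eqxx mul1n addnAC subnK.
      congr addn; apply: eq_bigr => i /negPf ij.
      by rewrite /pop_edge ij mul0n subn0.
    by move/familyP: xQ => /(_ l).
  by rewrite [l == j]eq_sym -!addnA addKn addnC addnA.
exists [seq unpop j (fun l => x l) G | x : {ffun 'I_d -> 'I_B} <- enum Q, G <- s x].
split.
- apply: allpairs_uniq_dep; first exact: enum_uniq.
    by move=> x; rewrite mem_enum => /Hs[].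
  move=> [x G] [x' G'] /allpairsPdep[x1 [G1 [+ + [-> ->]]]].
  move=> + + /allpairsPdep[x2 [G2 [+ + [-> ->]]]] /=.
  rewrite !mem_enum => /[dup] xQ /Hs[_ -> _] /and4P[_ /eqP tG _ _].
  move=> /[dup] xQ' /Hs[_ -> _] /and4P[_ /eqP tG' _ _].
  move=> /(unpop_inj tG tG')[Ex ->].
  by have -> : x1 = x2 by apply/ffunP => l; apply/val_inj/Ex.
- move=> F; rewrite unfold_in; apply/allpairsPdep/idP.
    move=> [x [G [+ + ->]]]; rewrite mem_enum => /[dup] xQ /Hs[_ -> _].
    apply: forest_class_unpop => //.
    by move=> l; move/familyP: xQ => /(_ l).
  move=> /forest_class_pop[x [G [xk CG ->]]].
  pose x' : {ffun 'I_d -> 'I_B} := [ffun l => inord (x l)].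
  have Ex l : x' l = x l :> nat.
    by rewrite ffunE inordK // (leq_ltn_trans (xk l)).
  have Ew : type_word (fun l => x' l) = type_word x.
    by rewrite /type_word; congr (sort _ (flatten _)); apply: eq_map => l; rewrite Ex.
  have x'Q : x' \in Q by apply/familyP => l; rewrite unfold_in Ex.
  exists x', G; rewrite mem_enum; split=> //; last by rewrite /unpop Ew.
  have [_ -> _] := Hs _ x'Q; rewrite unfold_in /C Ew.
  case/and4P: CG => wG tG nG /forallP kG; apply/and4P; split=> //.
  apply/forallP => i; apply/forallP => l; rewrite /pop_edge Ex.
  by move/forallP: (kG i); apply.
rewrite size_allpairs_dep sumnE big_map big_enum natr_sum /=.
rewrite -(@forest_formula_pop _ n k j B) //.
by apply: eq_bigr => x /Hs[].
Qed.
End Forests.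

(** * Transfer to the integer data of the theorem *)

Lemma mem_In (T : eqType) (s : seq T) y : List.In y s <-> y \in s.
Proof.
elim: s => //= z s IH; rewrite inE; split.
  by case=> [->|/IH ->]; rewrite ?eqxx ?orbT.
by case/orP => [/eqP->|/IH]; [left | right].
Qed.

Lemma uniq_NoDup (T : eqType) (s : seq T) : uniq s -> List.NoDup s.
Proof.
elim: s => [|z s IH] /=; first by constructor.
by case/andP => /negP zs /IH us; constructor => // /mem_In.
Qed.

Theorem theorem5p1 (d : nat) (hd : (2 <= d)%N)
    (r n : 'I_d -> int) (k : 'M[int]_d)
    (hr : forall i, 0 <= r i)
    (hr1 : 1 <= \sum_(i < d) r i)
    (hk : forall i j, i != j -> 0 <= k i j)
    (hkjj : forall j, - k j j = r j + \sum_(i < d | i != j) k i j)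
    (hn : forall i, - k i i <= n i)
    (hkpos : forall i, 0 < - k i i) :
  exists s : seq (pforest d),
    List.NoDup s /\
    (forall F, List.In F s <-> in_family r n k F) /\
    (size s)%:R =
      ((\det (- k))%:~R / \prod_(i < d) (n i)%:~R) *
      \prod_(i < d) \prod_(j < d)
         ('C(absz (n i + kprime n k i j - 1)%R, absz (kprime n k i j)))%:R
      :> rat.
Proof.
have n_gt0 i : 0 < n i by apply: lt_le_trans (hn i).
have En i : Posz (absz (n i)) = n i by rewrite gez0_abs // ltW.
have Er i : Posz (absz (r i)) = r i by rewrite gez0_abs.
have Ek i j : Posz (absz (kprime n k i j)) = kprime n k i j.
  rewrite gez0_abs // /kprime; case: eqP => [_|/eqP]; last exact: hk.
  by move: (hn i); rewrite -subr_ge0 opprK.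
(* Substituting [k'_jj = n_j + k_jj] into [hkjj] gives this balance of roots and children. *)
have Hn j : (absz (r j) + \sum_i absz (kprime n k i j) = absz (n j))%N.
  apply/eqP; rewrite -eqz_nat PoszD (big_morph Posz PoszD (erefl 0%:Z)) En Er.
  rewrite (eq_bigr _ (fun i _ => Ek i j)) (bigD1 j) //= {1}/kprime eqxx.
  have -> : \sum_(i | i != j) kprime n k i j = \sum_(i | i != j) k i j.
    by apply: eq_bigr => i /negPf ij; rewrite /kprime ij.
  by rewrite -addrA [r j + _]addrCA [r j + _]addrCA -hkjj subrr addr0.
pose nn i := absz (n i); pose kk i j := absz (kprime n k i j).
pose rr i := absz (r i).
(* Starting from the sorted word of root types encodes the order condition on the roots. *)
have [|s [us ms size_s]] := @forest_class_enum d (type_word rr) nn kk.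
  by move=> j; rewrite count_type_word Hn.
exists s; split; first exact: uniq_NoDup.
split.
  move=> F; rewrite mem_In ms unfold_in.
  split=> [/and4P[wF /eqP tF /forallP nF /forallP kF]|[/andP[sF wF] [nF [rF kF]]]].
    split; first by rewrite /wf_pforest wF type_sorted_ptype tF sorted_type_word.
    split; first by move=> i; rewrite (eqP (nF i)) En.
    split; first by move=> i; rewrite /nroots count_ptype tF count_type_word Er.
    move=> i j ij; have /forallP/(_ j)/eqP -> := kF i.
    by rewrite Ek /kprime (negPf ij).
  have nF' i : nvert i F = nn i by apply/eqP; rewrite -eqz_nat nF En.
  have rF' i : nroots i F = rr i by apply/eqP; rewrite -eqz_nat rF Er.
  have kF' i j : i != j -> nedge i j F = kk i j.
    by move=> ij; apply/eqP; rewrite -eqz_nat kF // Ek /kprime (negPf ij).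
  apply/and4P; split=> //.
  - rewrite -type_wordP -type_sorted_ptype sF; apply/forallP => l.
    by rewrite -count_ptype -/(nroots l F) rF'.
  - by apply/forallP => i; rewrite nF'.
  (* The diagonal edge count follows by cancelling the roots and the off-diagonal counts in the
     vertex balance. *)
  apply/forallP => i; apply/forallP => j; have [<-{j}|/kF' -> //] := eqVneq i j.
  have := nvert_roots_edges F i; rewrite nF' rF' -[nn i](Hn i) => /addnI.
  rewrite (bigD1 i) //= [in RHS](bigD1 i) //=.
  have -> : (\sum_(l | l != i) nedge l i F = \sum_(l | l != i) kk l i)%N.
    by apply: eq_bigr => l /kF'.
  by move=> /addIn <-.
rewrite size_s /forest_formula; congr (_ / _ * _).
(* All [n i] are positive, so [maxn 1] disappears, and the diagonal entry [n_i - k'_ii] equals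
   [- k_ii]. *)
- rewrite -det_map_mx; congr (\det _); apply/matrixP => i j; rewrite !mxE.
  have -> : maxn 1 (nn j) = nn j by apply/maxn_idPr; rewrite -ltz_nat En.
  rewrite -[(nn j)%:R]/((nn j)%:Z%:~R) -[(kk i j)%:R]/((kk i j)%:Z%:~R) En Ek.
  rewrite /kprime; case: eqP => [->|_]; last by rewrite mul0r sub0r rmorphN.
  by rewrite mul1r -rmorphB opprD addrA subrr sub0r.
- apply: eq_bigr => i _; have -> : maxn 1 (nn i) = nn i.
    by apply/maxn_idPr; rewrite -ltz_nat En.
  by rewrite -[(nn i)%:R]/((nn i)%:Z%:~R) En.
apply: eq_bigr => i _; apply: eq_bigr => j _; rewrite /multichoose.
congr ((binomial _ _)%:R).
by move: (n_gt0 i) (En i) (Ek i j); rewrite /nn /kk; lia.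
Qed.
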